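(* Let $T=(\Omega,(\Pi_i,t_i)_{i\in N})$ be an information structure and let $p\in\Delta(\Omega)$ be a maximal probability distribution. Then exactly one of the following statements holds: (1) $p$ is a universal common prior; (2) $p$ is a universal multiplayer money pump.
   Context: $\Omega$ is a finite nonempty set of states, $N=\{1,\dots,n\}$ is a finite nonempty set of players, and $\Delta(\Omega)$ is the set of probability measures on $\Omega$ (all subsets measurable). An information structure is a tuple $T=(\Omega,(\Pi_i,t_i)_{i\in N})$ where, for each $i$, $\Pi_i$ is a partition of $\Omega$ and $t_i\colon\Omega\to\Delta(\Omega)$ satisfies $t_i(\omega)(\pi_i(\omega))=1$ for every $\omega$, where $\pi_i(\omega)$ is the element of $\Pi_i$ containing $\omega$, and $t_i$ is constant on each element of $\Pi_i$. A prior of player $i$ is a $p\in\Delta(\Omega)$ such that $p(E\cap\pi)=t_i(\omega)(E)\,p(\pi)$ for all $E\subseteq\Omega$, $\pi\in\Pi_i$, $\omega\in\pi$; a common prior is a $p\in\Delta(\Omega)$ that is a prior of every player. A nonempty set $S\subseteq\Omega$ is a common certainty component if for every $\omega\in S$ and $i\in N$ there is $E\subseteq S$ with $t_i(\omega)(E)=1$. A distribution $p\in\Delta(\Omega)$ is maximal if $p(S)>0$ for every common certainty component $S$. A universal common prior is a common prior $p$ with $p(S)>0$ for every common certainty component $S$. An event $E\subseteq\Omega$ is commonly certain at $\omega$ if there is a common certainty component $S$ with $\omega\in S\subseteq E$. A semi-trade is a family $(f_i)_{i\in N}$ of functions $f_i\colon\Omega\to\mathbb{R}$ such that at every state $\omega\in\Omega$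 the event $\{\omega'\in\Omega:\int f_i\,\mathrm{d}t_i(\omega')\ge 0\text{ for all }i\in N\}$ is commonly certain. A distribution $p$ is a multiplayer money pump if there exists a semi-trade $(f_i)_{i\in N}$ with $\int\sum_{i\in N}f_i\,\mathrm{d}p<0$. A universal multiplayer money pump is a maximal distribution that is a multiplayer money pump. *)

(* Defs.v *)
From mathcomp Require Import all_boot all_order all_algebra.
From mathcomp Require Import all_classical all_reals all_analysis.

Set Implicit Arguments.
Unset Strict Implicit.
Unset Printing Implicit Defensive.

Import Order.TTheory GRing.Theory Num.Theory.

Local Open Scope classical_set_scope.
Local Open Scope ring_scope.
Local Open Scope ereal_scope.

(* The state space is a measurable type (hence pointed, hence nonempty); the
   definitions below are meant for a finite one on which every set is
   measurable, so that every real function on it is integrable. Players are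
   the elements of 'I_n. *)
Record info_structure d (Omega : measurableType d) (R : realType) (n : nat) :=
  InfoStructure {
    cells : 'I_n -> set (set Omega);
    belief : 'I_n -> Omega -> probability Omega R;
    cells_partition : forall i, partition (cells i) id [set: Omega];
    (* [pblock (cells i) id w] is the cell of player [i] containing [w] *)
    belief_cell : forall i w, belief i w (pblock (cells i) id w) = 1;
    belief_const : forall i P, cells i P ->
      forall w w', P w -> P w' -> belief i w = belief i w' }.

Section InfoStructureTheory.
Context d (Omega : measurableType d) (R : realType) (n : nat).
Variable T : info_structure Omega R n.
Implicit Types (p : probability Omega R) (S E : set Omega).

Definition prior (i : 'I_n) p : Prop :=
  forall E P w, cells T i P -> P w -> p (E `&` P) = belief T i w E * p P.

Definition common_prior p : Prop := forall i, prior i p.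

Definition common_certainty_component S : Prop :=
  S !=set0 /\
  forall w i, S w -> exists2 E, E `<=` S & belief T i w E = 1.

Definition maximal_distribution p : Prop :=
  forall S, common_certainty_component S -> 0 < p S.

Definition universal_common_prior p : Prop :=
  common_prior p /\ forall S, common_certainty_component S -> 0 < p S.

Definition commonly_certain E (w : Omega) : Prop :=
  exists S, [/\ common_certainty_component S, S w & S `<=` E].

Definition semi_trade (f : 'I_n -> Omega -> R) : Prop :=
  forall w, commonly_certain
    [set w' | forall i, 0 <= \int[belief T i w']_x (f i x)%:E] w.

Definition money_pump p : Prop :=
  exists2 f, semi_trade f & \int[p]_x (\sum_(i < n) f i x)%R%:E < 0.

Definition universal_money_pump p : Prop :=
  maximal_distribution p /\ money_pump p.

End InfoStructureTheory.

(* Main.v *)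
(** If [p] violates the prior identity of player [i] at an event [E] and a cell
    [P], the residual [1_(E & P) - t_i(E) 1_P] has zero conditional expectation
    for player [i] everywhere but a nonzero [p]-mean. Scaled by minus that mean
    and given to player [i] alone, it is a semi-trade with a negative [p]-mean.
    Conversely, a semi-trade has nonnegative conditional expectations at every
    state, and these average to a nonnegative mean under a common prior. *)

Require Import Defs.
From mathcomp Require Import all_boot all_order all_algebra.
From mathcomp Require Import all_classical all_reals all_analysis.

Set Implicit Arguments.
Unset Strict Implicit.
Unset Printing Implicit Defensive.

Import Order.TTheory GRing.Theory Num.Theory.

Local Open Scope classical_set_scope.
Local Open Scope ring_scope.

Section FiniteIntegral.
Context d (T : measurableType d) (R : realType) (s : seq T).
Hypotheses (uniq_s : uniq s) (setT_s : [set: T] = [set` s]).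
Hypothesis (discrete : forall A : set T, measurable A).
Variable mu : probability T R.

Lemma integrable_indic_scale (a : R) (A : set T) :
  mu.-integrable setT (fun x => (a * \1_A x)%:E).
Proof.
rewrite (_ : (fun x => _) = (fun x => a%:E * (\1_A x)%:E)%E); last first.
  by apply/funext => x; rewrite EFinM.
by apply: integrableZl => //; exact: integrable_indic.
Qed.

Lemma integral_indic_scale (a : R) (A : set T) :
  (\int[mu]_x (a * \1_A x)%:E)%E = (a * fine (mu A))%:E.
Proof.
under eq_integral do rewrite EFinM.
rewrite integralZl ?integral_indic ?setIT//; last exact: integrable_indic.
by rewrite EFinM fineK ?fin_num_measure.
Qed.

(** Expanding a function in point indicators makes integrability and the integral formula on a
    finite space consequences of linearity. *)
Lemma finite_funE (f : T -> R) x :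
  f x = \sum_(y <- s) f y * \1_[set y] x.
Proof.
have sx : x \in s by have : [set` s] x by rewrite -setT_s.
rewrite (bigD1_seq x)//= indicE mem_set// mulr1 big1 ?addr0// => y yx.
by rewrite indicE memNset ?mulr0// => /= xy; rewrite xy eqxx in yx.
Qed.

Lemma finite_integrable (f : T -> R) :
  mu.-integrable setT (fun x => (f x)%:E).
Proof.
rewrite (_ : (fun x => _) = fun x => (\sum_(y <- s) (f y * \1_[set y] x)%:E)%E).
  by apply: integrable_sum => // y _; exact: integrable_indic_scale.
by apply/funext => x; rewrite sumEFin -finite_funE.
Qed.

Lemma finite_integral (f : T -> R) :
  (\int[mu]_x (f x)%:E)%E = (\sum_(y <- s) f y * fine (mu [set y]))%:E.
Proof.
transitivity (\int[mu]_x (\sum_(y <- s) (f y * \1_[set y] x)%:E))%E.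
  by apply: eq_integral => x _; rewrite sumEFin -finite_funE.
rewrite integral_sum// => [|y]; last exact: integrable_indic_scale.
by rewrite -sumEFin; apply: eq_bigr => y _; rewrite integral_indic_scale.
Qed.

Lemma finite_measure_sum (A : set T) :
  fine (mu A) = \sum_(y <- s) \1_A y * fine (mu [set y]).
Proof.
apply: EFin_inj; rewrite -finite_integral integral_indic// setIT.
by rewrite fineK ?fin_num_measure.
Qed.

End FiniteIntegral.

Section InfoStructure.
Context (R : realType) (n : nat) d (Omega : measurableType d).
Hypothesis discrete : forall A : set Omega, measurable A.
Variable T : info_structure Omega R n.
Implicit Types (i : 'I_n) (p : probability Omega R) (P : set Omega).

Lemma cell_ex i w : exists P, cells T i P /\ P w.
Proof.
have [cT _ _] := cells_partition T i.
have : cover (cells T i) id w by rewrite cT.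
by case=> P iP Pw; exists P.
Qed.

Lemma cell_eq i P Q w : cells T i P -> cells T i Q -> P w -> Q w -> P = Q.
Proof.
by have [_ tI _] := cells_partition T i => iP iQ Pw Qw; apply: tI => //; exists w.
Qed.

Lemma belief_own_cell i P w : cells T i P -> P w -> belief T i w P = 1%E.
Proof.
move=> iP Pw; rewrite -(belief_cell T i w); congr (belief _ _ _ _).
(* [pblock] selects a cell by choice; [getPex] recovers that it is a cell containing [w], and there
   is only one such cell. *)
by have [iQ Qw] := getPex (cell_ex i w); exact: cell_eq iP iQ Pw Qw.
Qed.

(** Distinct cells are disjoint, so [A] avoids the cell of [w], which carries all the mass of the
    belief at [w]. *)
Lemma belief_sub_other_cell i P w (A : set Omega) :
  cells T i P -> ~ P w -> A `<=` P -> belief T i w A = 0%E.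
Proof.
move=> iP nPw AP; have [Q [iQ Qw]] := cell_ex i w.
have QC : belief T i w (~` Q) = 0%E.
  by rewrite probability_setC// belief_own_cell// subee.
apply: (subset_measure0 _ _ _ QC) => // x Ax Qx; apply: nPw.
by rewrite (cell_eq iP iQ (AP _ Ax) Qx).
Qed.

Lemma belief_own_cellI i P w (E : set Omega) : cells T i P -> P w ->
  belief T i w (E `&` P) = belief T i w E.
Proof.
move=> iP Pw.
have PC : belief T i w (~` P) = 0%E.
  by rewrite probability_setC// belief_own_cell// subee.
apply/esym; rewrite -[in LHS](setIT E) -(setUv P) setIUr.
rewrite measureU//; last by rewrite setIACA setICr setI0.
rewrite [X in (_ + X)%E](_ : _ = 0%E) ?adde0//.
exact: (subset_measure0 _ _ _ PC).
Qed.

Lemma certainty_componentT : common_certainty_component T setT.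
Proof.
by split=> [|w i _]; [exists point | exists setT => //; exact: probability_setT].
Qed.

(** Common certainty implies truth at the state itself; conversely, an event true everywhere is
    commonly certain, with the whole space as component. *)
Lemma semi_tradeP (f : 'I_n -> Omega -> R) :
  semi_trade T f <->
  forall w i, (0 <= \int[belief T i w]_x (f i x)%:E)%E.
Proof.
split=> [tf w|f_ge0 w].
  by have [S [_ Sw]] := tf w; exact.
exists setT; split=> //; first exact: certainty_componentT.
by move=> w' _ i; exact: f_ge0.
Qed.

Section Finite.
Variable s : seq Omega.
Hypotheses (uniq_s : uniq s) (setT_s : [set: Omega] = [set` s]).

(** Only states in the cell [P] of [x] contribute, and there the belief is constant, so the sum is
    the belief in [x] times the mass of [P]. The prior identity for the event [[set x]]
    concludes. *)
Lemma prior_belief_average i p x : prior T i p ->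
  \sum_(w <- s) fine (p [set w]) * fine (belief T i w [set x]) =
  fine (p [set x]).
Proof.
move=> ip; have [P [iP Px]] := cell_ex i x.
transitivity (fine (belief T i x [set x]) *
    \sum_(w <- s) \1_P w * fine (p [set w])).
  rewrite mulr_sumr; apply: eq_bigr => w _; rewrite indicE.
  have [Pw|nPw] := pselect (P w).
    by rewrite mem_set// (belief_const iP Pw Px) mul1r mulrC.
  rewrite memNset// mul0r mulr0 (belief_sub_other_cell iP nPw) ?mulr0//.
  by move=> _ ->.
rewrite -finite_measure_sum// -fineM ?fin_num_measure// -(ip _ _ x iP Px).
by rewrite setIidl// => _ ->.
Qed.

(** Law of total expectation: averaging the beliefs and exchanging the two sums turns the [p]-mean
    into a [p]-average of conditional expectations. *)
Lemma prior_integral_ge0 i p (f : Omega -> R) : prior T i p ->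
  (forall w, (0 <= \int[belief T i w]_x (f x)%:E)%E) ->
  (0 <= \int[p]_x (f x)%:E)%E.
Proof.
move=> ip f_ge0; rewrite (finite_integral uniq_s)// lee_fin.
under eq_bigr do rewrite -(prior_belief_average _ ip) mulr_sumr.
rewrite exchange_big /=; apply: sumr_ge0 => w _.
under eq_bigr do rewrite mulrCA.
by rewrite -mulr_sumr mulr_ge0 ?fine_ge0// -lee_fin -(finite_integral uniq_s).
Qed.

Lemma common_prior_no_money_pump p : common_prior T p -> ~ money_pump T p.
Proof.
move=> cp [f /semi_tradeP f_ge0]; apply/negP; rewrite -leNgt.
under eq_integral do rewrite -sumEFin.
rewrite integral_sum// => [|i]; last exact: (finite_integrable uniq_s).
by apply: sume_ge0 => i _; apply: (prior_integral_ge0 (cp i)).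
Qed.

End Finite.

(** This is a bet on [E] with stake [a] and price [c], called off outside [P]. It is fair for the
    player when [c] is the belief in [E] on the cell [P]. *)
Definition cell_residual (a c : R) (E P : set Omega) (x : Omega) : R :=
  a * \1_(E `&` P) x - a * c * \1_P x.

Lemma integral_cell_residual p a c E P :
  (\int[p]_x (cell_residual a c E P x)%:E)%E =
  (a * (fine (p (E `&` P)) - c * fine (p P)))%:E.
Proof.
under eq_integral do rewrite EFinB.
rewrite integralB_EFin//; try exact: integrable_indic_scale.
by rewrite !integral_indic_scale// -EFinB mulrBr mulrA.
Qed.

Lemma integral_belief_cell_residual i w w' a E P : cells T i P -> P w ->
  (\int[belief T i w']_x
     (cell_residual a (fine (belief T i w E)) E P x)%:E = 0)%E.
Proof.
move=> iP Pw; rewrite integral_cell_residual.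
have [Pw'|nPw'] := pselect (P w').
  rewrite (belief_const iP Pw Pw') belief_own_cellI// (belief_own_cell iP)//.
  by rewrite /= mulr1 subrr mulr0.
by rewrite !(belief_sub_other_cell iP nPw')//= mulr0 subrr mulr0.
Qed.

Lemma not_prior_money_pump i p : ~ prior T i p -> money_pump T p.
Proof.
move=> nip.
have [E [P [w [iP Pw neq]]]] : exists E P w, [/\ cells T i P, P w &
    p (E `&` P) <> (belief T i w E * p P)%E].
  apply: contrapT => H; apply: nip => E P w iP Pw; apply: contrapT => neq.
  by apply: H; exists E, P, w.
pose c := fine (belief T i w E).
pose r := fine (p (E `&` P)) - c * fine (p P).
have r_neq0 : r != 0.
  apply/eqP => /subr0_eq eq; apply: neq.
  rewrite -[LHS]fineK ?fin_num_measure// eq EFinM.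
  by rewrite /c !fineK ?fin_num_measure.
(* With stake [- r] the [p]-mean is minus the square of [r], hence negative whichever sign [r]
   has. *)
pose f j := if j == i then cell_residual (- r) c E P else cst 0.
exists f.
  apply/semi_tradeP => w' j; rewrite /f; case: eqP => [->|_].
    by rewrite integral_belief_cell_residual.
  by rewrite integral0.
rewrite (_ : (fun x => _) = fun x => (cell_residual (- r) c E P x)%:E).
  rewrite integral_cell_residual lte_fin mulNr oppr_lt0 -expr2.
  by rewrite exprn_even_gt0.
apply/funext => x; rewrite (bigD1 i)//= {1}/f eqxx big1 ?addr0// => j.
by rewrite /f => /negPf ->.
Qed.

End InfoStructure.

Theorem theorem57 (R : realType) (n : nat) (n_gt0 : (0 < n)%N)
    (d : measure_display) (Omega : measurableType d)
    (Omega_finite : finite_set [set: Omega])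
    (Omega_discrete : forall A : set Omega, measurable A)
    (T : info_structure Omega R n) (p : probability Omega R)
    (p_max : maximal_distribution T p) :
  (universal_common_prior T p \/ universal_money_pump T p) /\
  ~ (universal_common_prior T p /\ universal_money_pump T p).
Proof.
split.
  (* Both alternatives include maximality, so only common prior versus money pump remains to be
     decided. *)
  have [cp|ncp] := pselect (common_prior T p); [by left|right].
  split=> //; have /existsNP[i nip] := ncp.
  exact: (not_prior_money_pump Omega_discrete nip).
have /finite_seqP[s0 setT_s0] := Omega_finite.
(* Duplicates are removed so that sums over the list count each state once. *)
have setT_s : [set: Omega] = [set` undup s0].
  by rewrite setT_s0; apply/seteqP; split=> x /=; rewrite mem_undup.
move=> [[cp _] [_]].
exact: (common_prior_no_money_pump Omega_discrete (undup_uniq s0) setT_s cp).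
Qed.
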